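(* Let $A:\mathbb{R}^d\rightrightarrows\mathbb{R}^d$ be maximally monotone and $B:\mathbb{R}^d\to\mathbb{R}^d$ be $L_B$-Lipschitz and $\mu$-strongly monotone with $\mu>0$, and suppose $z^\star\in(A+B)^{-1}(0)$ exists. Let $\widetilde B$ be a stochastic oracle with $\mathbb{E}[\widetilde B(x)]=B(x)$ and $\mathbb{E}\|\widetilde B(x)-B(x)\|^2\le\sigma^2$. Starting from $z_0\in\mathbb{R}^d$, consider for $t=0,\dots,T-1$, with $\tau_t=\frac{2}{(t+1)\mu+6L_B}$, $$z_{t+1/2}=J_{\tau_tA}(z_t-\tau_t\widetilde B(z_t)),\qquad z_{t+1}=z_{t+1/2}+\tau_t\widetilde B(z_t)-\tau_t\widetilde B(z_{t+1/2}),$$ where each evaluation of $\widetilde B$ uses an independent sample. Then $$\mathbb{E}\|z_T-z^\star\|^2\le\frac{\frac{6L_B}{\mu}\|z_0-z^\star\|^2+\frac{48\sigma^2}{\mu^2}}{T+\frac{6L_B}{\mu}}.$$ Each iteration uses two evaluations of $\widetilde B$ and one resolvent of $A$.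
   Context: For an operator $A$, $J_A=(\mathrm{Id}+A)^{-1}$. $B$ is $\mu$-strongly monotone if $\langle B(x)-B(y),x-y\rangle\ge\mu\|x-y\|^2$ for all $x,y$. *)

(* Defs.v *)
From HB Require Import structures.
From Stdlib Require Import ClassicalEpsilon.
From mathcomp Require Import all_boot all_order all_algebra.
From mathcomp Require Import all_classical all_reals all_analysis.
Set Implicit Arguments. Unset Strict Implicit. Unset Printing Implicit Defensive.
Import Order.TTheory GRing.Theory Num.Theory.
Local Open Scope classical_set_scope.
Local Open Scope ring_scope.

Definition dotv {R : realType} {d : nat} (u v : 'rV[R]_d) : R :=
  \sum_(i < d) u 0 i * v 0 i.
Definition nrm2 {R : realType} {d : nat} (u : 'rV[R]_d) : R := dotv u u.
Definition enorm {R : realType} {d : nat} (u : 'rV[R]_d) : R := Num.sqrt (nrm2 u).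

(* Set-valued operators A : R^d ⇉ R^d, given by their graph: A x y <-> y ∈ A(x). *)
Definition setop (R : realType) (d : nat) := 'rV[R]_d -> 'rV[R]_d -> Prop.

Definition monotone_op {R : realType} {d : nat} (A : setop R d) : Prop :=
  forall x u y v, A x u -> A y v -> 0 <= dotv (u - v) (x - y).

Definition maximally_monotone {R : realType} {d : nat} (A : setop R d) : Prop :=
  monotone_op A /\
  forall A' : setop R d, monotone_op A' ->
    (forall x u, A x u -> A' x u) -> forall x u, A' x u -> A x u.

Definition lipschitz_op {R : realType} {d : nat} (B : 'rV[R]_d -> 'rV[R]_d) (L : R) :=
  forall x y, enorm (B x - B y) <= L * enorm (x - y).

Definition strongly_monotone {R : realType} {d : nat} (B : 'rV[R]_d -> 'rV[R]_d) (mu : R) :=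
  forall x y, mu * nrm2 (x - y) <= dotv (B x - B y) (x - y).

Definition scale_op {R : realType} {d : nat} (tau : R) (A : setop R d) : setop R d :=
  fun x y => exists u, A x u /\ y = tau *: u.

(* J_A = (Id + A)^{-1}: a (chosen) point p with x ∈ p + A(p)
   (single-valued when A is monotone, everywhere defined when A is maximally monotone). *)
Definition resolvent {R : realType} {d : nat} (A : setop R d) (x : 'rV[R]_d) : 'rV[R]_d :=
  epsilon (inhabits 0) (fun p => exists u, A p u /\ x = p + u).

Definition zero_of_sum {R : realType} {d : nat} (A : setop R d)
    (B : 'rV[R]_d -> 'rV[R]_d) (z : 'rV[R]_d) : Prop :=
  exists u, A z u /\ u + B z = 0.

(* Measurable structure on R^d: the (Borel) product sigma-algebra, through d-tuples. *)
Definition rV_of_tuple {R : realType} {d : nat} (s : d.-tuple R) : 'rV[R]_d :=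
  \row_j tnth s j.

Definition oracle_measurable {R : realType} {d : nat} {dX : measure_display}
    {X : measurableType dX} (G : 'rV[R]_d -> X -> 'rV[R]_d) : Prop :=
  forall i : 'I_d,
    measurable_fun [set: d.-tuple R * X]
      (fun p : d.-tuple R * X => G (rV_of_tuple p.1) p.2 0 i).

Definition mutually_independent {R : realType} {dO dX : measure_display}
    {Om : measurableType dO} {X : measurableType dX}
    (P : probability Om R) (xi : nat -> Om -> X) : Prop :=
  forall (s : seq nat) (B : nat -> set X), uniq s ->
    (forall k, measurable (B k)) ->
    P (\bigcap_(k in [set k | k \in s]) (xi k @^-1` B k)) =
    (\prod_(k <- s) P (xi k @^-1` B k))%E.

Definition stepsize {R : realType} (mu L : R) (t : nat) : R :=
  2 / (t.+1%:R * mu + 6 * L).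

Fixpoint iterate {R : realType} {d : nat} {dO dX : measure_display}
    {Om : measurableType dO} {X : measurableType dX}
    (A : setop R d) (G : 'rV[R]_d -> X -> 'rV[R]_d) (xi : nat -> Om -> X)
    (mu L : R) (z0 : 'rV[R]_d) (t : nat) (w : Om) : 'rV[R]_d :=
  match t with
  | 0 => z0
  | t'.+1 =>
      let z := iterate A G xi mu L z0 t' w in
      let tau := stepsize mu L t' in
      let g := G z (xi (2 * t')%N w) in
      let zh := resolvent (scale_op tau A) (z - tau *: g) in
      zh + tau *: g - tau *: G zh (xi (2 * t').+1 w)
  end.

(* Main.v *)
Require Import Defs.
From HB Require Import structures.
From mathcomp Require Import all_boot all_order all_algebra.
From mathcomp Require Import all_classical all_reals all_analysis.
From mathcomp Require Import measurable_realfun ring lra.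
Set Implicit Arguments. Unset Strict Implicit. Unset Printing Implicit Defensive.
Import Order.TTheory GRing.Theory Num.Theory.
Import numFieldNormedType.Exports.
Local Open Scope classical_set_scope.
Local Open Scope ring_scope.

(** The resolvents are everywhere defined by Minty's theorem, which here reduces
to a common point of the balls [|p - c| <= |w|], one for each point of the graph
of [A]. Over the convex hull of the points [(c, |c|^2 - |w|^2)] the function
[(p, r) |-> r - |p|^2] is at most [0] by monotonicity and strongly concave, so
its maximizing sequences are Cauchy; the first-order condition at the limit puts
[p] in every ball.

For fixed [z] and [g], monotonicity of [A] and strong monotonicity of [B] give
[|zh + tau g - tau B(zh) - zs|^2 <= (1 - tau mu) |z - zs|^2 + 2 tau^2 |g - B z|^2].
Replacing [B(zh)] by an independent unbiased sample costs [tau^2 sigma^2], and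
[|g - B z|^2] has mean at most [sigma^2], whence
[E D_(t+1) <= (1 - tau mu) E D_t + 3 tau^2 sigma^2] with [D_t = |z_t - zs|^2].
Independence enters through Tonelli: [(w, xi_k w)] has a product law when [w] is
observed through the sigma-algebra generated by [xi_0, ..., xi_(k-1)]. *)

(** * Euclidean inner product and norm on row vectors *)

Section Dot.
Context {R : realType} {d : nat}.
Implicit Types (u v w x y z : 'rV[R]_d).

Lemma dotvC u v : dotv u v = dotv v u.
Proof. by apply: eq_bigr => i _; rewrite mulrC. Qed.

Lemma dotvDl u v w : dotv (u + v) w = dotv u w + dotv v w.
Proof. by rewrite /dotv -big_split; apply: eq_bigr => i _; rewrite mxE mulrDl. Qed.

Lemma dotvZl a u v : dotv (a *: u) v = a * dotv u v.
Proof. by rewrite /dotv big_distrr; apply: eq_bigr => i _ /=; rewrite mxE mulrA. Qed.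

Lemma dotvNl u v : dotv (- u) v = - dotv u v.
Proof. by rewrite -scaleN1r dotvZl mulN1r. Qed.

Lemma dotvDr u v w : dotv w (u + v) = dotv w u + dotv w v.
Proof. by rewrite !(dotvC w) dotvDl. Qed.

Lemma dotvZr a u v : dotv v (a *: u) = a * dotv v u.
Proof. by rewrite !(dotvC v) dotvZl. Qed.

Lemma dotvNr u v : dotv v (- u) = - dotv v u.
Proof. by rewrite !(dotvC v) dotvNl. Qed.

Definition dotvE := (dotvDl, dotvDr, dotvNl, dotvNr, dotvZl, dotvZr).

Lemma nrm2_ge0 u : 0 <= nrm2 u.
Proof. by apply: sumr_ge0 => i _; rewrite -expr2 sqr_ge0. Qed.

Lemma enorm_sqr u : enorm u ^+ 2 = nrm2 u.
Proof. by rewrite sqr_sqrtr ?nrm2_ge0. Qed.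

Lemma coord_sqr_le_nrm2 u i : u 0 i ^+ 2 <= nrm2 u.
Proof.
rewrite /nrm2 /dotv (bigD1 i) //= expr2 lerDl.
by apply: sumr_ge0 => j _; rewrite -expr2 sqr_ge0.
Qed.

Lemma nrm2D_le u v : nrm2 (u + v) <= 2 * nrm2 u + 2 * nrm2 v.
Proof.
have := nrm2_ge0 (u - v).
rewrite /nrm2 !dotvE (dotvC v u); lra.
Qed.

Lemma nrm2_le_l1 u : nrm2 u <= (\sum_(i < d) `|u 0 i|) ^+ 2.
Proof.
rewrite expr2 big_distrl; apply: ler_sum => i _ /=.
rewrite -expr2 -real_normK ?num_real// expr2 ler_wpM2l//.
by rewrite (bigD1 i) //= lerDl sumr_ge0.
Qed.

End Dot.

(** * Maximal monotonicity, Minty's theorem and resolvents *)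

Section Minty.
Context {R : realType} {d : nat}.
Implicit Types (A : setop R d) (x y u v : 'rV[R]_d).

(** An empty graph would be properly extended by the monotone graph [{(0, 0)}]. *)
Lemma maximally_monotone_nonempty A :
  maximally_monotone A -> exists x u, A x u.
Proof.
move=> [_ maxA]; apply: contrapT => A0.
apply: (A0); exists 0, 0.
apply: (maxA (fun x u => x = 0 /\ u = 0)) => //.
- move=> x u y v [-> ->] [-> ->].
  by rewrite subr0 /dotv big1// => i _; rewrite mxE mul0r.
- by move=> x u Axu; exfalso; apply: A0; exists x, u.
Qed.

(** Adjoining the single pair [(x, u)] keeps the graph monotone, so maximality forces the pair to be
    there already. *)
Lemma maximally_monotoneP A x u : maximally_monotone A ->
  (forall y v, A y v -> 0 <= dotv (u - v) (x - y)) -> A x u.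
Proof.
move=> [monA maxA] xuA.
apply: (maxA (fun y v => A y v \/ (y = x /\ v = u))); [|by left|by right].
move=> y v y' v' [Ayv|[-> ->]] [Ayv'|[-> ->]]; [exact: monA| |exact: xuA|].
- rewrite -(opprB u) -(opprB x) dotvNl dotvNr opprK; exact: xuA.
- by rewrite !subrr /dotv big1// => i _; rewrite mxE mul0r.
Qed.

Lemma scale_op_maximally_monotone A (tau : R) :
  0 < tau -> maximally_monotone A -> maximally_monotone (scale_op tau A).
Proof.
move=> tau0 mA; have [monA _] := mA; split.
  move=> x _ y _ [u [Au ->]] [v [Av ->]].
  by rewrite -scalerBr dotvZl; apply: mulr_ge0; [exact: ltW|exact: monA].
move=> A' monA' subA' x u A'xu.
exists (tau^-1 *: u); split; last by rewrite scalerA divff ?scale1r ?gt_eqF.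
apply: (maximally_monotoneP mA) => y v Ayv.
have /(monA' _ _ _ _ A'xu) : A' y (tau *: v) by apply: subA'; exists v.
have -> : tau^-1 *: u - v = tau^-1 *: (u - tau *: v).
  by rewrite scalerBr scalerA mulVf ?scale1r ?gt_eqF.
by rewrite dotvZl => ?; apply: mulr_ge0 => //; rewrite invr_ge0 ltW.
Qed.

(* For a point [(y, v)] of the graph, [0 <= <v - (x - p), y - p>] reads
   [|p - c|^2 <= |w|^2] with [c = (y - (v - x)) / 2] and [w = (y + (v - x)) / 2].
   The hull is that of the triples [(c, |c|^2 - |w|^2, w)]; carrying [w] along
   makes the bound [minty_hull_pair] affine in each of its two points. *)
Inductive minty_hull A x : 'rV[R]_d -> R -> 'rV[R]_d -> Prop :=
| minty_gen y v of A y v :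
    minty_hull A x (2^-1 *: (y - (v - x)))
      (nrm2 (2^-1 *: (y - (v - x))) - nrm2 (2^-1 *: (y + (v - x))))
      (2^-1 *: (y + (v - x)))
| minty_mix t p r q p' r' q' of 0 <= t <= 1 &
    minty_hull A x p r q & minty_hull A x p' r' q' :
    minty_hull A x ((1 - t) *: p + t *: p') ((1 - t) * r + t * r')
      ((1 - t) *: q + t *: q').

(** For two generators this is monotonicity in the form [|c - c'|^2 <= |w - w'|^2]. Both sides are
    affine in each triple, so mixing preserves the inequality. *)
Lemma minty_hull_pair A x p r q p' r' q' : monotone_op A ->
  minty_hull A x p r q -> minty_hull A x p' r' q' ->
  r + r' <= 2 * dotv p p' - 2 * dotv q q'.
Proof.
move=> monA; elim=> {p r q} [y v Ayv|t p1 r1 q1 p2 r2 q2 /andP[t0 t1] _ IH1 _ IH2 H].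
- elim=> {p' r' q'} [y' v' Ayv'|t p1 r1 q1 p2 r2 q2 /andP[t0 t1] _ IH1 _ IH2].
  + have := monA _ _ _ _ Ayv Ayv'.
    rewrite /nrm2 !dotvE.
    rewrite ?(dotvC y' y) ?(dotvC v y) ?(dotvC v' y) ?(dotvC x y) ?(dotvC v y').
    rewrite ?(dotvC v' y') ?(dotvC x y') ?(dotvC v' v) ?(dotvC x v) ?(dotvC x v').
    lra.
  + move: IH1 IH2; rewrite !(dotvDr, dotvZr).
    move: (nrm2 _ - nrm2 _) (dotv _ p1) (dotv _ p2) (dotv _ q1) (dotv _ q2).
    move=> a b c e f; nra.
- move: (IH1 H) (IH2 H); rewrite !(dotvDl, dotvZl).
  move: (dotv p1 p') (dotv p2 p') (dotv q1 q') (dotv q2 q') => a b c e; nra.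
Qed.

Lemma minty_hull_le A x p r q : monotone_op A -> minty_hull A x p r q ->
  r - nrm2 p <= 0.
Proof.
move=> monA h; have := minty_hull_pair monA h h.
have := nrm2_ge0 q; rewrite /nrm2; lra.
Qed.

Lemma minty A x : maximally_monotone A -> exists p u, A p u /\ x = p + u.
Proof.
move=> mA; have [monA _] := mA.
pose phi : set R := [set s | exists p r q, minty_hull A x p r q /\ s = r - nrm2 p].
have phi_sup : has_sup phi.
  split.
    have [y [v Ayv]] := maximally_monotone_nonempty mA.
    by do 4 eexists; split; [exact: (minty_gen x Ayv)|reflexivity].
  by exists 0 => _ [p [r [q [h ->]]]]; exact: minty_hull_le h.
have le_sup p r q : minty_hull A x p r q -> r - nrm2 p <= sup phi.
  by move=> h; apply: sup_upper_bound => //; exists p, r, q.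
have sup_le0 : sup phi <= 0.
  apply: ge_sup; first by case: phi_sup.
  by move=> _ [p [r [q [h ->]]]]; exact: minty_hull_le h.
have /choice[p p_max] (n : nat) : exists p, exists r q,
    minty_hull A x p r q /\ sup phi - n.+1%:R^-1 < r - nrm2 p.
  have n0 : 0 < n.+1%:R^-1 :> R by rewrite invr_gt0 ltr0n.
  have [_ [p [r [q [h ->]]]] hlt] := sup_adherent n0 phi_sup.
  by exists p, r, q.
(* The midpoint of two hull points has as value the mean of their values plus [|p m - p n|^2 / 4],
   and this is at most [sup phi]. *)
have p_cauchy m n : nrm2 (p m - p n) <= 2 * m.+1%:R^-1 + 2 * n.+1%:R^-1.
  have [r [q [h hm]]] := p_max m; have [r' [q' [h' hn]]] := p_max n.
  have half01 : 0 <= (2^-1 : R) <= 1 by lra.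
  have := le_sup _ _ _ (minty_mix half01 h h').
  move: hm hn; rewrite /nrm2 !dotvE (dotvC (p n) (p m)).
  move: m.+1%:R^-1 n.+1%:R^-1 => a b; lra.
have p_cvg i : cvg (p n 0 i @[n --> \oo]).
  apply/cauchy_cvgP/cauchy_exP => e e0 /=.
  (* With both reciprocals below [e^2 / 4], [p_cauchy] gives [|p N - p n|^2 < e^2]. *)
  have e20 : 0 < e ^+ 2 / 4 by rewrite divr_gt0// exprn_gt0.
  have [N _ hN] := near_infty_natSinv_lt (PosNum e20).
  exists (p N 0 i); exists N => // n /= Nn.
  rewrite /ball /= -(@ltr_pXn2r _ 2)// ?nnegrE ?(ltW e0)//.
  rewrite real_normK ?num_real//.
  apply: le_lt_trans (_ : nrm2 (p N - p n) < _).
    by have := coord_sqr_le_nrm2 (p N - p n) i; rewrite !mxE.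
  apply: le_lt_trans (p_cauchy _ _) _.
  have := hN N (leqnn _); have := hN n Nn => /=.
  by move: N.+1%:R^-1 n.+1%:R^-1 => a b; lra.
pose P : 'rV[R]_d := \row_i limn (fun n => p n 0 i).
have nrm2_cvg c : nrm2 (p n - c) @[n --> \oo] --> nrm2 (P - c).
  rewrite /nrm2 /dotv; apply: cvg_big => [|i _]; first exact: add_continuous.
  have pc : (p n - c) 0 i @[n --> \oo] --> (P - c) 0 i.
    under eq_fun do rewrite !mxE.
    by rewrite !mxE; apply: cvgB; [exact: p_cvg|exact: cvg_cst].
  exact: cvgM.
(* Lying in the ball of [(y, v)] is [<(x - P) - v, P - y> >= 0] rewritten, so maximality puts
   [x - P] in [A(P)]. *)
suff P_max y v : A y v ->
    nrm2 (P - 2^-1 *: (y - (v - x))) <= nrm2 (2^-1 *: (y + (v - x))).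
  exists P, (x - P); split; last by rewrite addrC subrK.
  apply: (maximally_monotoneP mA) => y v /P_max.
  rewrite /nrm2 !dotvE.
  rewrite ?(dotvC y P) ?(dotvC v P) ?(dotvC x P) ?(dotvC v y) ?(dotvC x y).
  rewrite ?(dotvC x v); lra.
move=> Ayv; set c := 2^-1 *: (y - _); set w := 2^-1 *: (y + _).
(* Moving [p n] a fraction [t] towards [c] cannot push the value above [sup phi]. Since
   [sup phi <= 0], dividing by [t] leaves [(1 - t) |p n - c|^2 <= |w|^2 + 1 / (t (n + 1))], and [n]
   tends to infinity. *)
have P_max_t (t : R) : 0 < t < 1 -> (1 - t) * nrm2 (P - c) <= nrm2 w.
  move=> /andP[t0 t1].
  apply: (@ler_cvg_to _ \oo _ _ (fun n => (1 - t) * nrm2 (p n - c))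
            (fun n => nrm2 w + t^-1 * n.+1%:R^-1)).
  - by apply: cvgM; [exact: cvg_cst|exact: nrm2_cvg].
  - rewrite -[X in _ --> X]addr0; apply: cvgD; first exact: cvg_cst.
    by rewrite -(mulr0 t^-1); apply: cvgM; [exact: cvg_cst|exact: cvg_harmonic].
  - apply: nearW => n.
    have [r [q [h hn]]] := p_max n.
    have t01 : 0 <= t <= 1 by rewrite !ltW.
    have := le_sup _ _ _ (minty_mix t01 h (minty_gen x Ayv)).
    rewrite -/c -/w => hle.
    have n0 : 0 < n.+1%:R^-1 :> R by rewrite invr_gt0 ltr0n.
    rewrite -(ler_pM2l t0) mulrDr mulVKf ?gt_eqF//.
    move: hle hn; rewrite /nrm2 !dotvE ?(dotvC c (p n)).
    move: (dotv (p n) (p n)) (dotv (p n) c) (dotv c c) (dotv w w) n0 => a b e f n0.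
    move: sup_le0 n0; move: (sup phi) n.+1%:R^-1 => s g; nra.
have := nrm2_ge0 w; have := nrm2_ge0 (P - c).
move: P_max_t; move: (nrm2 (P - c)) (nrm2 w) => a b Pt a0 b0.
rewrite leNgt; apply/negP => ba.
have a_gt0 : 0 < a by lra.
(* For [a > b] this choice of [t] makes [(1 - t) a] the mean of [a] and [b], which exceeds [b]. *)
have t01 : 0 < (a - b) / (2 * a) < 1.
  by apply/andP; split; [apply: divr_gt0; lra|rewrite ltr_pdivrMr; lra].
have := Pt _ t01.
have -> : (1 - (a - b) / (2 * a)) * a = (a + b) / 2 by field; rewrite gt_eqF.
lra.
Qed.

Lemma resolvent_spec A (tau : R) x : 0 < tau -> maximally_monotone A ->
  exists u, A (resolvent (scale_op tau A) x) u /\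
            x = resolvent (scale_op tau A) x + tau *: u.
Proof.
move=> tau0 mA.
have ex : exists p, exists u, scale_op tau A p u /\ x = p + u.
  exact/minty/scale_op_maximally_monotone.
have [_ [[u [Au ->]] xE]] := ClassicalEpsilon.epsilon_spec (inhabits 0) _ ex.
by exists u.
Qed.

(** Writing [x - x' = (p - p') + tau (u - u')] with [u] in [A(p)] and [u'] in [A(p')], the cross
    term is nonnegative by monotonicity. *)
Lemma resolvent_nonexpansive A (tau : R) x x' :
  0 < tau -> maximally_monotone A ->
  nrm2 (resolvent (scale_op tau A) x - resolvent (scale_op tau A) x') <=
  nrm2 (x - x').
Proof.
move=> tau0 mA; have [monA _] := mA.
have [u [Au xE]] := resolvent_spec x tau0 mA.
have [u' [Au' xE']] := resolvent_spec x' tau0 mA.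
set p := resolvent _ x in Au xE *; set p' := resolvent _ x' in Au' xE' *.
have -> : x - x' = (p - p') + tau *: (u - u').
  by rewrite xE xE' scalerBr opprD addrACA.
have := mulr_ge0 (ltW tau0) (monA _ _ _ _ Au Au').
have := nrm2_ge0 (tau *: (u - u')).
rewrite /nrm2 (dotvDl (p - p')) !(dotvDr (p - p')) (dotvC (p - p') (tau *: _)).
rewrite (dotvZl _ (u - u') (p - p')); lra.
Qed.

End Minty.

(** * Deterministic estimate for one iteration *)

Section Descent.
Context {R : realType} {d : nat}.
Implicit Types (A : setop R d) (B : 'rV[R]_d -> 'rV[R]_d).

Lemma lipschitz_nrm2 B L x y : lipschitz_op B L ->
  nrm2 (B x - B y) <= L ^+ 2 * nrm2 (x - y).
Proof.
move=> /(_ x y) lipB; rewrite -!enorm_sqr -exprMn.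
have B0 : 0 <= enorm (B x - B y) by exact: sqrtr_ge0.
by rewrite lerXn2r ?nnegrE// (le_trans B0).
Qed.

(** Together the two properties of [B] give [(mu^2 - L^2) |x|^2 <= 0]. The second alternative is the
    zero-dimensional space. *)
Lemma strong_monotone_le_lipschitz B L mu : 0 <= L -> lipschitz_op B L ->
  0 < mu -> strongly_monotone B mu ->
  mu <= L \/ forall x : 'rV[R]_d, nrm2 x = 0.
Proof.
move=> L0 lipB mu0 smB.
case: (lerP mu L) => Lmu; [by left|right => x].
apply/eqP; rewrite eq_le nrm2_ge0 andbT.
have := smB x 0; have := lipschitz_nrm2 x 0 lipB; rewrite subr0.
move: (B x - B 0) => U; have := nrm2_ge0 (mu *: x - U); have := nrm2_ge0 x.
rewrite /nrm2 !dotvE (dotvC x U) => X0 h1 h2 h3.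
have h4 : (mu ^+ 2 - L ^+ 2) * dotv x x <= 0.
  by have := ler_wpM2l (ltW mu0) h3; lra.
have h5 : 0 < mu ^+ 2 - L ^+ 2 by nra.
by rewrite pmulr_rle0 in h4.
Qed.

(** Applied with [a = zh - zs], [b = z - zh], [c = B z - B zh], [e = g - B z], [f = g - B zh],
    [D = B zh - B zs]. Expanding the left side leaves [|a + b|^2 - |b|^2 - 2 tau mu |a|^2 + tau^2
    |f|^2]. Then [|a + b|^2 <= 2 |a|^2 + 2 |b|^2] trades the term in [|a|^2] for the contraction,
    and the smallness of [tau] lets [- |b|^2] absorb the rest. *)
Lemma fbf_inequality (a b c e f D : 'rV[R]_d) (L mu tau : R) :
  0 < mu -> 0 < tau -> 2 * tau ^+ 2 * L ^+ 2 + 2 * tau * mu <= 1 ->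
  f = e + c -> 0 <= dotv (b - tau *: (f + D)) a ->
  mu * nrm2 a <= dotv D a -> nrm2 c <= L ^+ 2 * nrm2 b ->
  nrm2 (a + tau *: f) <=
  (1 - tau * mu) * nrm2 (a + b) + 2 * tau ^+ 2 * nrm2 e.
Proof.
move=> mu0 tau0 tau_small fE hmon hsm hlip.
have hf := nrm2D_le e c; rewrite -fE {fE} in hf.
have k1 := ler_wpM2l (sqr_ge0 tau) hf.
have k2 := ler_wpM2l (sqr_ge0 tau) hlip.
have k3 := ler_wpM2l (ltW tau0) hsm.
have k4 := ler_wpM2l (nrm2_ge0 b) tau_small.
have k5 := mulr_ge0 (ltW (mulr_gt0 tau0 mu0)) (nrm2_ge0 (a - b)).
move: hmon k1 k2 k3 k4 k5; rewrite /nrm2 !dotvE (dotvC b a) (dotvC f a); lra.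
Qed.

Lemma fbf_descent A B L mu tau z g zs zh :
  maximally_monotone A -> lipschitz_op B L -> strongly_monotone B mu ->
  zero_of_sum A B zs -> 0 < mu -> 0 < tau ->
  2 * tau ^+ 2 * L ^+ 2 + 2 * tau * mu <= 1 ->
  zh = resolvent (scale_op tau A) (z - tau *: g) ->
  nrm2 (zh + tau *: g - tau *: B zh - zs) <=
  (1 - tau * mu) * nrm2 (z - zs) + 2 * tau ^+ 2 * nrm2 (g - B z).
Proof.
move=> mA lipB smB [v [Av vE]] mu0 tau0 tau_small zhE.
have [monA _] := mA.
have [u [Au zE]] := resolvent_spec (z - tau *: g) tau0 mA.
rewrite -zhE {zhE} in Au zE.
have -> : zh + tau *: g - tau *: B zh - zs = (zh - zs) + tau *: (g - B zh).
  by apply/rowP => i; rewrite !mxE; ring.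
have -> : z - zs = (zh - zs) + (z - zh) by rewrite [RHS]addrC addrA subrK.
apply: (@fbf_inequality _ _ (B z - B zh) _ _ (B zh - B zs) L) => //.
- by rewrite addrA subrK.
(* Here [u] lies in [A(zh)] by the resolvent equation and [v = - B zs] in [A(zs)], so the claim
   becomes monotonicity of [A]. *)
- have -> : z - zh - tau *: (g - B zh + (B zh - B zs)) = tau *: (u - v).
    have -> : v = - B zs by apply/eqP; rewrite -addr_eq0 vE.
    have -> : z = zh + tau *: u + tau *: g by rewrite -zE subrK.
    by apply/rowP => i; rewrite !mxE; ring.
  by rewrite dotvZl; apply: mulr_ge0; [exact: ltW|exact: monA].
- exact: lipschitz_nrm2.
Qed.

End Descent.

(** * Measurability of vector-valued maps *)

Section LipschitzMeasurable.
Context {R : realType} {d : nat} {dO : measure_display} {Om : measurableType dO}.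

Definition measurable_rV (Y : Om -> 'rV[R]_d) :=
  forall i, measurable_fun [set: Om] (fun w => Y w 0 i).

Lemma measurable_fun_ltP (f : Om -> R) :
  (forall r, measurable [set w | f w < r]) -> measurable_fun [set: Om] f.
Proof.
move=> mf; apply: (measurability _ (RGenInftyO.measurableE R)) => //.
move=> _ [_ [r ->] <-]; rewrite setTI.
suff -> : f @^-1` `]-oo, r[ = [set w | f w < r] by exact: mf.
by apply/seteqP; split => w /=; rewrite in_itv.
Qed.

(* A Lipschitz [f] is the infimum of the functions [f q + K |. - q|] over
   rational [q], so only countably many comparisons are needed. *)
Lemma lipschitz_measurable_comp (f : 'rV[R]_d -> R) (K : R) (Y : Om -> 'rV[R]_d) :
  0 <= K ->
  (forall x y, f x - f y <= K * \sum_(i < d) `|x 0 i - y 0 i|) ->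
  measurable_rV Y -> measurable_fun [set: Om] (fun w => f (Y w)).
Proof.
move=> K0 lipf mY; apply: measurable_fun_ltP => r.
pose q2r (q : 'rV[rat]_d) : 'rV[R]_d := \row_i ratr (q 0 i).
pose near q w := f (q2r q) + K * \sum_(i < d) `|Y w 0 i - q2r q 0 i|.
have -> : [set w | f (Y w) < r] = \bigcup_q [set w | near q w < r].
  apply/seteqP; split => w /=; last first.
    move=> [q _] /=; apply: le_lt_trans.
    by rewrite /near addrC -lerBlDr; exact: lipf.
  (* A rational point within [e] in each coordinate has [near q w <= f (Y w) + 2 K d e < r]. The
     added ones keep the denominator positive and the inequality strict. *)
  move=> fr; pose e := (r - f (Y w)) / (2 * (K + 1) * (d%:R + 1)).
  have e0 : 0 < e.
    by rewrite divr_gt0 ?subr_gt0// !mulr_gt0// ltr_wpDl// ?ler0n.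
  have /choice[q qY] i : exists q : rat, `|Y w 0 i - ratr q| < e.
    have [q] := @rat_in_itvoo R (Y w 0 i - e) (Y w 0 i + e) ltac:(lra).
    rewrite in_itv /= => /andP[q1 q2]; exists q.
    by rewrite ltr_norml; apply/andP; split; lra.
  exists (\row_i q i) => //=; rewrite /near.
  have : \sum_(i < d) `|Y w 0 i - q2r (\row_i q i) 0 i| <= d%:R * e.
    rewrite mulr_natl -[X in _ *+ X]card_ord -sumr_const; apply: ler_sum => i _.
    by rewrite !mxE ltW.
  have := lipf (q2r (\row_i q i)) (Y w).
  under eq_bigr do rewrite distrC.
  set S := \sum_(i < d) _ => h1 h2.
  have h3 : K * S <= K * (d%:R * e) by rewrite ler_wpM2l.
  have h4 : 2 * (K * (d%:R * e)) < r - f (Y w); last lra.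
  rewrite /e; set D := d%:R; have D0 : 0 <= D by rewrite ler0n.
  have -> : 2 * (K * (D * ((r - f (Y w)) / (2 * (K + 1) * (D + 1))))) =
     (r - f (Y w)) * ((K * D) / ((K + 1) * (D + 1))).
    by field; apply/andP; split; rewrite gt_eqF//; lra.
  rewrite -[X in _ < X]mulr1 ltr_pM2l ?subr_gt0// ltr_pdivrMr; nra.
apply: countable_bigcupT_measurable => // q.
have mnear : measurable_fun [set: Om] (near q).
  apply: measurable_funD => //; apply: measurable_funM => //.
  apply: measurable_sum => i; apply: measurableT_comp => //.
  exact: measurable_funB.
rewrite -[X in measurable X]setTI.
have /(_ measurableT [set true]) := measurable_fun_ltr mnear (measurable_cst r).
have mtrue : measurable [set true] by [].
move/(_ mtrue); congr (measurable (_ `&` _)).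
Qed.

(** Each coordinate is [K]-Lipschitz for the [l^1] distance, because [|u_i| <= |u| <= |u|_1]. *)
Lemma nrm2_lipschitz_measurable (F : 'rV[R]_d -> 'rV[R]_d) (K : R)
    (Y : Om -> 'rV[R]_d) :
  0 <= K -> (forall x y, nrm2 (F x - F y) <= K ^+ 2 * nrm2 (x - y)) ->
  measurable_rV Y -> measurable_rV (fun w => F (Y w)).
Proof.
move=> K0 lipF mY i.
apply: (@lipschitz_measurable_comp (fun x => F x 0 i) K) => // x y.
have S0 : 0 <= K * \sum_(j < d) `|x 0 j - y 0 j|.
  by rewrite mulr_ge0// sumr_ge0.
apply: le_trans (ler_norm _) _.
rewrite -(@ler_pXn2r _ 2)// ?nnegrE// real_normK ?num_real// exprMn.
have := coord_sqr_le_nrm2 (F x - F y) i; rewrite !mxE => /le_trans; apply.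
apply: le_trans (lipF _ _) _; rewrite ler_wpM2l ?sqr_ge0//.
by apply: le_trans (nrm2_le_l1 _) _; under eq_bigr do rewrite !mxE.
Qed.

Lemma measurable_rVD (Y Z : Om -> 'rV[R]_d) :
  measurable_rV Y -> measurable_rV Z -> measurable_rV (fun w => Y w + Z w).
Proof.
by move=> mY mZ i; under eq_fun do rewrite mxE; exact: measurable_funD.
Qed.

Lemma measurable_rVZ (a : R) (Y : Om -> 'rV[R]_d) :
  measurable_rV Y -> measurable_rV (fun w => a *: Y w).
Proof.
by move=> mY i; under eq_fun do rewrite mxE; exact: measurable_funM.
Qed.

Lemma measurable_rVB (Y Z : Om -> 'rV[R]_d) :
  measurable_rV Y -> measurable_rV Z -> measurable_rV (fun w => Y w - Z w).
Proof.
move=> mY mZ; under eq_fun do rewrite -scaleN1r.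
exact/measurable_rVD/measurable_rVZ.
Qed.

Lemma measurable_rV_cst (y : 'rV[R]_d) : measurable_rV (fun=> y).
Proof. by move=> i; exact: measurable_cst. Qed.

Lemma measurable_nrm2 (Y : Om -> 'rV[R]_d) :
  measurable_rV Y -> measurable_fun [set: Om] (fun w => nrm2 (Y w)).
Proof. by move=> mY; apply: measurable_sum => i; exact: measurable_funM. Qed.

Lemma measurable_oracle {dX : measure_display} {X : measurableType dX}
    (G : 'rV[R]_d -> X -> 'rV[R]_d) (Y : Om -> 'rV[R]_d) (xi : Om -> X) :
  oracle_measurable G -> measurable_rV Y -> measurable_fun [set: Om] xi ->
  measurable_rV (fun w => G (Y w) (xi w)).
Proof.
move=> mG mY mxi i.
pose t w : d.-tuple R := [tuple Y w 0 j | j < d].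
have -> : (fun w => G (Y w) (xi w) 0 i) =
    (fun p : d.-tuple R * X => G (rV_of_tuple p.1) p.2 0 i) \o (fun w => (t w, xi w)).
  apply/funext => w /=; congr (G _ _ _ _).
  by apply/rowP => j; rewrite !mxE tnth_mktuple.
apply: measurableT_comp; first exact: mG.
apply: measurable_fun_pair => //; apply/measurable_fun_tnthP => j.
by rewrite (_ : _ \o _ = fun w => Y w 0 j)//; apply/funext => w /=; rewrite tnth_mktuple.
Qed.

End LipschitzMeasurable.

(** * Integrating out an independent variable *)

Section Independence.
Context {R : realType} {dO dX dU : measure_display} {Om : measurableType dO}
  {X : measurableType dX} {U : measurableType dU} (P : probability Om R).
Local Open Scope ereal_scope.

(** This stands in for conditional expectation: under the product law of [(Y, xi)], Tonelli
    integrates [xi] first with [Y] frozen at [u]. *)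
Lemma integral_independent_le (Y : Om -> U) (xi : Om -> X)
    (F : U * X -> \bar R) (H : U -> \bar R) :
  measurable_fun [set: Om] Y -> measurable_fun [set: Om] xi ->
  (forall M C, measurable M -> measurable C ->
    P ((Y @^-1` M) `&` (xi @^-1` C)) = P (Y @^-1` M) * P (xi @^-1` C)) ->
  measurable_fun setT F -> (forall p, 0 <= F p) ->
  measurable_fun setT H ->
  (forall u, \int[P]_w F (u, xi w) <= H u) ->
  \int[P]_w F (Y w, xi w) <= \int[P]_w H (Y w).
Proof.
move=> mY mxi indep mF F0 mH FH.
have mYxi : measurable_fun [set: Om] (fun w => (Y w, xi w)).
  exact: measurable_fun_pair.
pose Y' : {mfun Om >-> U} := HB.pack Y (isMeasurableFun.Build _ _ _ _ _ mY).
pose xi' : {mfun Om >-> X} := HB.pack xi (isMeasurableFun.Build _ _ _ _ _ mxi).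
pose Yxi : {mfun Om >-> (U * X)%type} :=
  HB.pack (fun w => (Y w, xi w)) (isMeasurableFun.Build _ _ _ _ _ mYxi).
have -> : \int[P]_w F (Y w, xi w) = \int[distribution P Yxi]_p F p.
  by rewrite ge0_integral_distribution.
have H0 u : 0 <= H u by apply: le_trans (FH u); exact: integral_ge0.
have -> : \int[P]_w H (Y w) = \int[distribution P Y']_u H u.
  by rewrite ge0_integral_distribution.
rewrite (@eq_measure_integral _ _ _ _ (distribution P Y' \x distribution P xi')).
  rewrite fubini_tonelli1//; apply: ge0_le_integral => //.
  - by move=> u _; exact: integral_ge0.
  - exact: measurable_fun_fubini_tonelli_F.
  - move=> u _; apply: le_trans (FH u).
    rewrite /fubini_F ge0_integral_distribution//.
    exact: measurable_fun_pair2.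
move=> M mM _; apply/esym; apply: product_measure_unique mM; exact: indep.
Qed.

End Independence.

(** * The sigma-algebra of past samples *)

Section Past.
Context {R : realType} {dO dX : measure_display} {Om : measurableType dO}
  {X : measurableType dX} (P : probability Om R) (xi : nat -> Om -> X).
Hypothesis mxi : forall k, measurable_fun [set: Om] (xi k).
Hypothesis ixi : mutually_independent P xi.

(* The pi-system generating the sigma-algebra of [xi 0, ..., xi (k - 1)]. *)
Definition past (k : nat) : set (set Om) :=
  [set E | exists B : nat -> set X, (forall j, measurable (B j)) /\
     E = \bigcap_(j in [set j | j \in iota 0 k]) (xi j @^-1` B j)].

(** The carrier is still [Om]; only the sigma-algebra is coarser, so measurability on this type
    expresses dependence on the first [k] samples. *)
Definition pastType (k : nat) : measurableType _ := g_sigma_algebraType (past k).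

Lemma measurable_preimage k C : measurable C -> measurable (xi k @^-1` C).
Proof. by move=> mC; rewrite -[X in measurable X]setTI; exact: mxi. Qed.

Lemma past_measurable k : past k `<=` measurable.
Proof.
move=> _ [B [mB ->]]; apply: bigcap_measurableType => j _.
exact: measurable_preimage.
Qed.

Lemma past_setI k : setI_closed (past k).
Proof.
move=> _ _ [B [mB ->]] [C [mC ->]]; exists (fun j => B j `&` C j); split.
  by move=> j; exact: measurableI.
by rewrite -bigcapI; apply: eq_bigcapr => j _; rewrite preimage_setI.
Qed.

Lemma past_setT k : past k setT.
Proof.
exists (fun=> setT); split => //.
by apply/esym; apply: bigcapT => j _.
Qed.

(** Compares the product formula for the indices [0, ..., k] with the one for [0, ..., k - 1]. *)
Lemma past_independent k E C : past k E -> measurable C ->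
  P (E `&` (xi k @^-1` C)) = (P E * P (xi k @^-1` C))%E.
Proof.
move=> [B [mB ->]] mC.
pose B' j := if j == k then C else B j.
have mB' j : measurable (B' j) by rewrite /B'; case: ifP.
have k_notin : k \notin iota 0 k by rewrite mem_iota add0n ltnn andbF.
have B'E j : j \in iota 0 k -> B' j = B j.
  by rewrite mem_iota add0n /B' => /andP[_ /ltn_eqF ->].
have u : uniq (k :: iota 0 k) by rewrite /= k_notin iota_uniq.
have := ixi u mB'.
rewrite big_cons (eq_big_seq (fun j => P (xi j @^-1` B j))); last first.
  by move=> j /B'E ->.
rewrite -(ixi (iota_uniq 0 k) mB) {2}/B' eqxx muleC => <-.
congr (P _); apply/seteqP; split => w /=.
  move=> [hB hC] j /=; rewrite inE => /orP[/eqP ->|jk].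
    by rewrite /B' eqxx.
  by rewrite B'E//; exact: hB.
move=> h; split=> [j /= jk|].
  by have := h j; rewrite /= inE jk orbT B'E// => /(_ isT).
by have := h k; rewrite /= inE eqxx /B' eqxx => /(_ isT).
Qed.

(** As functions of [E] both sides are finite measures that agree on the pi-system [past k], hence
    on the sigma-algebra it generates. *)
Lemma pastType_independent k E C : <<s past k >> E -> measurable C ->
  P (E `&` (xi k @^-1` C)) = (P E * P (xi k @^-1` C))%E.
Proof.
move=> sE mC.
have mxC : measurable (xi k @^-1` C) by exact: measurable_preimage.
have r0 : 0 <= fine (P (xi k @^-1` C)) by rewrite fine_ge0// measure_ge0.
have PC : ((fine (P (xi k @^-1` C)))%:E = P (xi k @^-1` C))%E.
  by rewrite fineK// fin_num_measure.
have scaleE A : mscale (NngNum r0) P A = (P A * P (xi k @^-1` C))%E.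
  by rewrite muleC -[in RHS]PC.
rewrite -scaleE; move: E sE.
apply: (@g_sigma_algebra_measure_unique _ _ _ (past k) (@past_measurable k)
  (fun=> setT) (fun=> past_setT k) _ (mrestr P mxC) (mscale (NngNum r0) P)
  (@past_setI k)).
- by rewrite bigcup_const//; exists 0%N.
- by move=> A pA; apply: etrans (esym (scaleE A)); exact: past_independent.
- by move=> _; rewrite /= /mrestr setTI -PC ltry.
Qed.

Lemma measurable_past_id k :
  measurable_fun [set: Om] (id : Om -> pastType k).
Proof.
move=> _ A mA; rewrite setTI preimage_id.
move: mA; apply: smallest_sub; last exact: past_measurable.
exact: sigma_algebra_measurable.
Qed.

Lemma measurable_past k j : (j < k)%N ->
  measurable_fun [set: pastType k] (xi j).
Proof.
move=> jk _ C mC; rewrite setTI; apply: sub_sigma_algebra.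
exists (fun i => if i == j then C else setT); split.
  by move=> i; case: ifP.
apply/seteqP; split => w /=.
  by move=> wC i /= _; case: eqP => [->|].
by move=> /(_ j); rewrite /= mem_iota add0n jk eqxx; apply.
Qed.

Lemma integral_past_le k (F : pastType k * X -> \bar R) (H : pastType k -> \bar R) :
  measurable_fun setT F -> (forall p, 0 <= F p)%E -> measurable_fun setT H ->
  (forall u, \int[P]_w F (u, xi k w) <= H u)%E ->
  (\int[P]_w F (w, xi k w) <= \int[P]_w H w)%E.
Proof.
move=> mF F0 mH FH.
apply: (@integral_independent_le _ _ _ _ _ _ _ P (id : Om -> pastType k) (xi k)) => //.
- exact: measurable_past_id.
- by move=> M C mM mC; rewrite preimage_id; exact: pastType_independent.
Qed.

End Past.

(** * Mean square after an unbiased perturbation *)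

Section Variance.
Context {R : realType} {d : nat} {dO : measure_display} {Om : measurableType dO}
  (P : probability Om R).

(** In the expanded square the cross term [<e, g - b>], called [lin] below, has mean zero since [g]
    has mean [b]. *)
Lemma integral_nrm2_shift_le (g : Om -> 'rV[R]_d) (b e : 'rV[R]_d) (tau s : R) :
  (forall i, P.-integrable [set: Om] (fun w => (g w 0 i)%:E) /\
     (\int[P]_w (g w 0 i)%:E = (b 0 i)%:E)%E) ->
  (\int[P]_w (nrm2 (g w - b))%:E <= s%:E)%E ->
  (\int[P]_w (nrm2 (e - tau *: (g w - b)))%:E <=
     (nrm2 e + tau ^+ 2 * s)%:E)%E.
Proof.
move=> gb var_s.
have mg : measurable_rV g.
  by move=> i; have [/measurable_int/measurable_EFinP] := gb i.
have mgb : measurable_rV (fun w => g w - b).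
  exact: measurable_rVB mg (measurable_rV_cst _).
have int_cst (c : R) : P.-integrable [set: Om] (fun=> c%:E).
  exact: finite_measure_integrable_cst.
have int_var : P.-integrable [set: Om] (fun w => (nrm2 (g w - b))%:E).
  apply/integrableP; split; first exact/measurable_EFinP/measurable_nrm2.
  under eq_integral do rewrite gee0_abs ?lee_fin ?nrm2_ge0//.
  exact: le_lt_trans var_s (ltry _).
have int_coord i : P.-integrable [set: Om] (fun w => (g w 0 i)%:E - (b 0 i)%:E)%E.
  exact: integrableB (gb i).1 (int_cst _).
pose lin w := (\sum_(i < d) (e 0 i)%:E * ((g w 0 i)%:E - (b 0 i)%:E))%E.
have int_lin : P.-integrable [set: Om] lin.
  by apply: integrable_sum => // i _; exact: integrableZl.
have lin0 : (\int[P]_w lin w = 0)%E.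
  rewrite /lin integral_sum//; last by move=> i; exact: integrableZl.
  apply: big1 => i _; rewrite integralZl// integralB//; last exact: (gb i).1.
  rewrite (gb i).2 integral_cst//= probability_setT mule1.
  by rewrite -EFinB subrr mule0.
have expand w : (nrm2 (e - tau *: (g w - b)))%:E =
    ((nrm2 e)%:E + (tau ^+ 2)%:E * (nrm2 (g w - b))%:E + (- (2 * tau))%:E * lin w)%E.
  have -> : lin w = (dotv e (g w - b))%:E.
    by rewrite /lin /dotv -sumEFin; apply: eq_bigr => i _; rewrite !mxE EFinM EFinB.
  rewrite -!EFinM -!EFinD; congr EFin.
  move: (g w - b) => f; rewrite /nrm2 !dotvE (dotvC f e); ring.
under eq_integral do rewrite expand.
have int_sq : P.-integrable [set: Om]
    (fun w => (tau ^+ 2)%:E * (nrm2 (g w - b))%:E)%E by exact: integrableZl.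
rewrite integralD//; [|exact: integrableD|exact: integrableZl].
rewrite integralD// integralZl// integralZl// lin0 mule0 adde0.
rewrite integral_cst//= probability_setT mule1 [leRHS]EFinD leeD2l//.
by rewrite [leRHS]EFinM lee_wpmul2l// lee_fin sqr_ge0.
Qed.

End Variance.

(** * Step sizes and measurability of the iterates *)

Section Iterates.
Context {R : realType} {d : nat} {dX : measure_display} {X : measurableType dX}.
Variables (A : setop R d) (B : 'rV[R]_d -> 'rV[R]_d) (L mu : R)
  (G : 'rV[R]_d -> X -> 'rV[R]_d) (z0 : 'rV[R]_d).
Hypotheses (mA : maximally_monotone A) (L0 : 0 <= L) (mu0 : 0 < mu)
  (lipB : lipschitz_op B L) (mG : oracle_measurable G).

Lemma stepsize_gt0 t : 0 < stepsize mu L t.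
Proof.
rewrite divr_gt0// ltr_wpDr ?mulr_ge0//.
by rewrite mulr_gt0// ltr0n.
Qed.

(** With [p = tau mu <= q = tau L], the step size gives [p + 6 q <= 2]. Hence [q <= 1/3] and
    [2 q^2 + 2 p <= (2/3) q + 2 p <= 1]. *)
Lemma stepsize_small t : mu <= L ->
  2 * stepsize mu L t ^+ 2 * L ^+ 2 + 2 * stepsize mu L t * mu <= 1.
Proof.
move=> muL; set tau := stepsize mu L t.
have tau0 : 0 < tau by exact: stepsize_gt0.
have : tau * (t.+1%:R * mu + 6 * L) = 2.
  by rewrite /tau /stepsize mulfVK// gt_eqF// ltr_wpDr ?mulr_ge0// mulr_gt0// ltr0n.
have : 1 <= t.+1%:R :> R by rewrite ler1n.
move: (t.+1%:R : R) => n n1 tauE.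
have h : tau * (mu + 6 * L) <= 2.
  by rewrite -tauE ler_pM2l// lerD2r; exact: ler_peMl (ltW mu0) n1.
have h1 : tau * mu <= tau * L by rewrite ler_pM2l.
have h2 : 0 < tau * mu by rewrite mulr_gt0.
have -> : 2 * tau ^+ 2 * L ^+ 2 + 2 * tau * mu = 2 * (tau * L) ^+ 2 + 2 * (tau * mu).
  by ring.
have : tau * mu + 6 * (tau * L) <= 2 by lra.
move: h1 h2; move: (tau * mu) (tau * L) => p q pq p0 hpq.
have : q * q <= q * 3^-1 by rewrite ler_wpM2l; lra.
lra.
Qed.

Lemma measurable_resolvent {dO : measure_display} {Om : measurableType dO}
    (tau : R) (Y : Om -> 'rV[R]_d) : 0 < tau -> measurable_rV Y ->
  measurable_rV (fun w => resolvent (scale_op tau A) (Y w)).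
Proof.
move=> tau0 mY; apply: (nrm2_lipschitz_measurable ler01) => // x y.
by rewrite expr1n mul1r; exact: resolvent_nonexpansive.
Qed.

Lemma measurable_half_step {dO : measure_display} {Om : measurableType dO}
    (xi : nat -> Om -> X) t (z : Om -> 'rV[R]_d) :
  measurable_rV z -> measurable_fun [set: Om] (xi (2 * t)%N) ->
  measurable_rV (fun w => resolvent (scale_op (stepsize mu L t) A)
    (z w - stepsize mu L t *: G (z w) (xi (2 * t)%N w))).
Proof.
move=> mz mxi; apply: measurable_resolvent; first exact: stepsize_gt0.
by apply: measurable_rVB => //; apply/measurable_rVZ/measurable_oracle.
Qed.

(* The measurable structure on the sample space is an argument of the fixpoint
   [iterate], so changing it is not a conversion even when the carrier is the same. *)
Lemma iterate_comp {dO dO' : measure_display} {Om : measurableType dO}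
    {Om' : measurableType dO'} (xi : nat -> Om -> X) (f : Om' -> Om) t w :
  iterate A G (fun k w' => xi k (f w')) mu L z0 t w =
  iterate A G xi mu L z0 t (f w).
Proof. by elim: t => //= t ->. Qed.

(** Measurability is asked only of the samples below [2 t], which is what makes the lemma applicable
    on a past sigma-algebra. *)
Lemma measurable_iterate {dO : measure_display} {Om : measurableType dO}
    (xi : nat -> Om -> X) t :
  (forall j, (j < 2 * t)%N -> measurable_fun [set: Om] (xi j)) ->
  measurable_rV (iterate A G xi mu L z0 t).
Proof.
elim: t => [|t IH] mxi; first exact: measurable_rV_cst.
have mxi0 : measurable_fun [set: Om] (xi (2 * t)%N).
  by apply: mxi; rewrite mulnS addnC addn2.
have mxi1 : measurable_fun [set: Om] (xi (2 * t).+1).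
  by apply: mxi; rewrite mulnS addnC addn2.
have mz : measurable_rV (iterate A G xi mu L z0 t).
  by apply: IH => j jt; apply: mxi; rewrite mulnS ltn_addl.
have mzh := measurable_half_step mz mxi0.
apply: measurable_rVB; last by apply/measurable_rVZ/measurable_oracle.
by apply: measurable_rVD => //; apply/measurable_rVZ/measurable_oracle.
Qed.

(** * Expected descent in one iteration *)

Section Step.
Context {dO : measure_display} {Om : measurableType dO} (P : probability Om R).
Variables (xi : nat -> Om -> X) (sigma : R) (zs : 'rV[R]_d).
Hypotheses (smB : strongly_monotone B mu) (zsP : zero_of_sum A B zs)
  (mxi : forall k, measurable_fun [set: Om] (xi k))
  (ixi : mutually_independent P xi)
  (unbiased : forall k x (i : 'I_d),
      P.-integrable [set: Om] (fun w => (G x (xi k w) 0 i)%:E) /\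
      (\int[P]_w (G x (xi k w) 0 i)%:E = (B x 0 i)%:E)%E)
  (variance : forall k x,
      (\int[P]_w (nrm2 (G x (xi k w) - B x))%:E <= (sigma ^+ 2)%:E)%E).

Lemma measurable_lipschitz {dU : measure_display} {U : measurableType dU}
    (Y : U -> 'rV[R]_d) : measurable_rV Y -> measurable_rV (fun u => B (Y u)).
Proof.
apply: nrm2_lipschitz_measurable L0 _ => x y; exact: lipschitz_nrm2.
Qed.

Lemma measurable_rV_fst {dU : measure_display} {U : measurableType dU}
    (Y : U -> 'rV[R]_d) : measurable_rV Y ->
  measurable_rV (fun p : U * X => Y p.1).
Proof. by move=> mY i; exact: (measurableT_comp (mY i) measurable_fst). Qed.

Let z t := iterate A G xi mu L z0 t.

Lemma measurable_iterate_past k t : (2 * t <= k)%N ->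
  measurable_rV (z t : pastType xi k -> _).
Proof.
move=> tk.
have mpast j : (j < 2 * t)%N -> measurable_fun [set: pastType xi k] (xi j).
  by move=> jt; apply: measurable_past; exact: leq_trans jt tk.
move=> i; rewrite (_ : (fun w => _) =
    fun w : pastType xi k => @iterate R d _ _ (pastType xi k) X A G xi mu L z0 t w 0 i).
  exact: (@measurable_iterate _ (pastType xi k) xi t mpast).
apply/funext => w; congr (fun_of_matrix _ _ _).
exact/esym/(iterate_comp xi (id : pastType xi k -> Om)).
Qed.

(** The sample [xi (2 t)] is independent of the past that determines [z t], so the variance bound
    applies with [z t] frozen. *)
Lemma oracle_error_le t :
  (\int[P]_w (nrm2 (G (z t w) (xi (2 * t)%N w) - B (z t w)))%:E <=
     (sigma ^+ 2)%:E)%E.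
Proof.
have mz : measurable_rV (z t : pastType xi (2 * t) -> _).
  exact: measurable_iterate_past.
have -> : (sigma ^+ 2)%:E = (\int[P]_w (sigma ^+ 2)%:E)%E.
  by rewrite integral_cst//= probability_setT mule1.
apply: (integral_past_le mxi ixi
  (F := fun p => (nrm2 (G (z t p.1) p.2 - B (z t p.1)))%:E)
  (H := fun=> (sigma ^+ 2)%:E)) => //.
- apply/measurable_EFinP/measurable_nrm2/measurable_rVB.
    by apply: measurable_oracle => //; exact: (measurable_rV_fst mz).
  by apply: measurable_lipschitz; exact: (measurable_rV_fst mz).
- by move=> p; rewrite lee_fin nrm2_ge0.
- by move=> u /=; exact: (variance (2 * t)%N (z t u)).
Qed.

Lemma expected_descent t : mu <= L ->
  (\int[P]_w (nrm2 (z t.+1 w - zs))%:E <=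
   (1 - stepsize mu L t * mu)%:E * \int[P]_w (nrm2 (z t w - zs))%:E +
   (3 * stepsize mu L t ^+ 2 * sigma ^+ 2)%:E)%E.
Proof.
move=> muL; set tau := stepsize mu L t.
have tau0 : 0 < tau by exact: stepsize_gt0.
have tau_small := stepsize_small t muL; rewrite -/tau in tau_small.
have taumu : 0 <= 1 - tau * mu.
  have := sqr_ge0 (tau * L); have := mulr_gt0 tau0 mu0.
  by rewrite exprMn; lra.
(* The index of the second sample: the past at [k] contains [xi (2 t)], so [z t], [g] and [zh] are
   all measurable for it. *)
pose k := (2 * t).+1.
pose g w := G (z t w) (xi (2 * t)%N w).
pose zh w := resolvent (scale_op tau A) (z t w - tau *: g w).
have mz : measurable_rV (z t : pastType xi k -> _).
  exact: measurable_iterate_past.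
have mxk : measurable_fun [set: pastType xi k] (xi (2 * t)%N).
  exact: measurable_past.
have mg : measurable_rV (g : pastType xi k -> _) by exact: measurable_oracle.
have mzh : measurable_rV (zh : pastType xi k -> _).
  exact: measurable_half_step.
pose F (p : pastType xi k * X) :=
  (nrm2 (zh p.1 + tau *: g p.1 - tau *: G (zh p.1) p.2 - zs))%:E.
pose H (w : pastType xi k) := ((1 - tau * mu) * nrm2 (z t w - zs) +
  2 * tau ^+ 2 * nrm2 (g w - B (z t w)) + tau ^+ 2 * sigma ^+ 2)%:E.
have mz' : measurable_rV (z t) by apply: measurable_iterate.
have mg' : measurable_rV g by exact: measurable_oracle.
have mdist dU (U : measurableType dU) (y : U -> 'rV[R]_d) : measurable_rV y ->
    measurable_fun setT (fun w => nrm2 (y w - zs)).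
  by move=> my; apply/measurable_nrm2/measurable_rVB => //; exact: measurable_rV_cst.
have merr dU (U : measurableType dU) (y h : U -> 'rV[R]_d) : measurable_rV y ->
    measurable_rV h -> measurable_fun setT (fun w => nrm2 (h w - B (y w))).
  move=> my mh; apply/measurable_nrm2/measurable_rVB => //.
  exact: measurable_lipschitz.
have FH : (\int[P]_w F (w, xi k w) <= \int[P]_w H w)%E.
  apply: (integral_past_le mxi ixi) => //.
  - apply/measurable_EFinP/mdist/measurable_rVB.
      apply: measurable_rVD; first exact: (measurable_rV_fst mzh).
      by apply: measurable_rVZ; exact: (measurable_rV_fst mg).
    by apply/measurable_rVZ/measurable_oracle => //; exact: (measurable_rV_fst mzh).
  - by move=> p; rewrite lee_fin nrm2_ge0.
  - apply/measurable_EFinP; apply: measurable_funD => //.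
    by apply: measurable_funD; apply: measurable_funM => //; [exact: mdist|exact: merr].
  - move=> u; rewrite /F /=.
    (* The update with the exact value [B (zh u)] plays the role of [e], and [fbf_descent] then
       bounds its squared norm. *)
    have := integral_nrm2_shift_le (zh u + tau *: g u - tau *: B (zh u) - zs) tau
       (unbiased k (zh u)) (variance k (zh u)).
    under eq_integral => w _.
      have -> : zh u + tau *: g u - tau *: B (zh u) - zs -
        tau *: (G (zh u) (xi k w) - B (zh u)) =
        zh u + tau *: g u - tau *: G (zh u) (xi k w) - zs.
        by apply/rowP => i; rewrite !mxE; ring.
      over.
    move/le_trans; apply; rewrite lee_fin lerD2r.
    exact: (fbf_descent (g := g u) mA lipB).
apply: le_trans FH _.
have mD : measurable_fun setT (fun w => ((1 - tau * mu) * nrm2 (z t w - zs))%:E).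
  by apply/measurable_EFinP; apply: measurable_funM => //; exact: mdist.
have mE : measurable_fun setT
    (fun w => (2 * tau ^+ 2 * nrm2 (g w - B (z t w)))%:E).
  by apply/measurable_EFinP; apply: measurable_funM => //; exact: merr.
have tau20 : 0 <= 2 * tau ^+ 2 by rewrite mulr_ge0 ?sqr_ge0.
have D0 w : (0 <= ((1 - tau * mu) * nrm2 (z t w - zs))%:E)%E.
  by rewrite lee_fin mulr_ge0 ?nrm2_ge0.
have E0 w : (0 <= (2 * tau ^+ 2 * nrm2 (g w - B (z t w)))%:E)%E.
  by rewrite lee_fin mulr_ge0 ?nrm2_ge0.
rewrite /H; under eq_integral do rewrite !EFinD.
rewrite ge0_integralD//; last 3 first.
- by move=> w _; exact: adde_ge0.
- exact: emeasurable_funD mD mE.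
- by move=> w _; rewrite lee_fin mulr_ge0 ?sqr_ge0.
rewrite (ge0_integralD _ measurableT) //.
under eq_integral do rewrite EFinM.
rewrite ge0_integralZl_EFin//; last 2 first.
- by move=> w _; rewrite lee_fin nrm2_ge0.
- by apply/measurable_EFinP; exact: mdist.
under [X in (_ + X + _)%E]eq_integral do rewrite EFinM.
rewrite ge0_integralZl_EFin//; last 2 first.
- by move=> w _; rewrite lee_fin nrm2_ge0.
- by apply/measurable_EFinP; exact: merr.
rewrite integral_cst//= probability_setT mule1 -addeA leeD2l//.
(* The first sample contributes [2 tau^2 sigma^2] and the second [tau^2 sigma^2]. *)
apply: (@le_trans _ _ ((2 * tau ^+ 2)%:E * (sigma ^+ 2)%:E +
  (tau ^+ 2 * sigma ^+ 2)%:E)%E).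
  rewrite leeD2r// lee_wpmul2l ?lee_fin//.
  exact: oracle_error_le.
by rewrite -EFinM -EFinD lee_fin; lra.
Qed.

End Step.
End Iterates.

(** * Solving the recursion and concluding *)

(** The induction step for the bound [M / (t + kappa)]. With [n = t + kappa] the slack is
    [(M (n + 1) - 12 c n) / (n (n + 1)^2)], nonnegative since [M >= 12 c >= 0]. *)
Lemma descent_rate (R : realType) (kappa c M : R) (t : nat) :
  1 < kappa -> 0 <= c -> 12 * c <= M ->
  (1 - 2 / (t.+1%:R + kappa)) * (M / (t%:R + kappa)) +
    12 * c / (t.+1%:R + kappa) ^+ 2 <= M / (t.+1%:R + kappa).
Proof.
move=> kappa1 c0 cM; rewrite -[t.+1%:R]natr1.
have -> : t%:R + 1 + kappa = t%:R + kappa + 1 by ring.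
have : 1 < t%:R + kappa by rewrite ltr_wpDl.
move: (t%:R + kappa) => n n1.
have n0 : n != 0 by rewrite gt_eqF//; lra.
have n10 : n + 1 != 0 by rewrite gt_eqF//; lra.
rewrite -subr_ge0.
have -> : M / (n + 1) - ((1 - 2 / (n + 1)) * (M / n) + 12 * c / (n + 1) ^+ 2) =
  (M * (n + 1) - 12 * c * n) / (n * (n + 1) ^+ 2) by field; rewrite n0 n10.
apply: divr_ge0; first by nra.
by rewrite mulr_ge0 ?sqr_ge0//; lra.
Qed.

Theorem theoremC1 (R : realType) (d : nat)
  (A : setop R d) (B : 'rV[R]_d -> 'rV[R]_d) (L mu sigma : R)
  (dO dX : measure_display) (Om : measurableType dO) (X : measurableType dX)
  (P : probability Om R) (xi : nat -> Om -> X) (G : 'rV[R]_d -> X -> 'rV[R]_d)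
  (zs z0 : 'rV[R]_d) (T : nat) :
  maximally_monotone A ->
  0 <= L -> lipschitz_op B L ->
  0 < mu -> strongly_monotone B mu ->
  zero_of_sum A B zs ->
  (forall k, measurable_fun [set: Om] (xi k)) ->
  mutually_independent P xi ->
  oracle_measurable G ->
  (forall k x (i : 'I_d),
      P.-integrable [set: Om] (fun w => (G x (xi k w) 0 i)%:E) /\
      (\int[P]_w (G x (xi k w) 0 i)%:E = (B x 0 i)%:E)%E) ->
  (forall k x,
      (\int[P]_w (nrm2 (G x (xi k w) - B x))%:E <= (sigma ^+ 2)%:E)%E) ->
  (\int[P]_w (nrm2 (iterate A G xi mu L z0 T w - zs))%:E <=
     (((6 * L / mu) * nrm2 (z0 - zs) + 48 * sigma ^+ 2 / mu ^+ 2)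
        / (T%:R + 6 * L / mu))%:E)%E.
Proof.
move=> mA L0 lipB mu0 smB zsP mxi ixi mG unbiased variance.
have c0 : 0 <= sigma ^+ 2 / mu ^+ 2 by rewrite divr_ge0 ?sqr_ge0.
rewrite -(mulrA 48); set c := sigma ^+ 2 / mu ^+ 2 in c0 *.
(* In dimension zero both distances vanish and the bound is nonnegative. Otherwise [mu <= L] gives
   [kappa >= 6]. *)
have [muL|nrm2_0] := strong_monotone_le_lipschitz L0 lipB mu0 smB; last first.
  under eq_integral do rewrite nrm2_0.
  rewrite integral0 lee_fin nrm2_0 mulr0 add0r.
  apply: divr_ge0; first exact: mulr_ge0.
  by apply: addr_ge0 => //; apply: divr_ge0; [exact: mulr_ge0|exact: ltW].
have kappa6 : 6 <= 6 * L / mu by rewrite ler_pdivlMr//; lra.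
set kappa := 6 * L / mu in kappa6 *.
set M := kappa * nrm2 (z0 - zs) + 48 * c.
have cM : 12 * c <= M.
  have : 0 <= kappa * nrm2 (z0 - zs) by rewrite mulr_ge0 ?nrm2_ge0//; lra.
  by rewrite /M; lra.
(* The bound proved is [M / (T + kappa)]; at [T = 0] it equals [|z0 - zs|^2 + 48 c / kappa]. *)
elim: T => [|t IH].
  rewrite /= integral_cst//= probability_setT mule1 lee_fin mulr0n add0r.
  by rewrite /M ler_pdivlMr; lra.
have tauE : stepsize mu L t = 2 / (mu * (t.+1%:R + kappa)).
  by rewrite /stepsize mulrDr (mulrC mu (6 * L / mu)) divfK ?gt_eqF// (mulrC mu).
apply: le_trans (expected_descent z0 mA L0 mu0 lipB mG smB zsP mxi ixi
  unbiased variance t muL) _.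
have kappa1 : 1 < kappa by lra.
have s0 : 0 < t.+1%:R + kappa by rewrite addr_gt0// ?ltr0n//; lra.
have taumuE : stepsize mu L t * mu = 2 / (t.+1%:R + kappa).
  by rewrite tauE; move: (_ + kappa) s0 => s s0; field; rewrite !gt_eqF.
have tausE : 3 * stepsize mu L t ^+ 2 * sigma ^+ 2 = 12 * c / (t.+1%:R + kappa) ^+ 2.
  by rewrite tauE /c; move: (_ + kappa) s0 => s s0; field; rewrite !gt_eqF.
have t1 : 1 <= t.+1%:R :> R by rewrite ler1n.
(* The contraction factor must be nonnegative for the induction hypothesis to be multiplied by
   it. *)
have q0 : 0 <= 1 - 2 / (t.+1%:R + kappa).
  by rewrite subr_ge0 ler_pdivrMr//; lra.
rewrite taumuE tausE.
apply: (@le_trans _ _ ((1 - 2 / (t.+1%:R + kappa))%:E * (M / (t%:R + kappa))%:E +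
   (12 * c / (t.+1%:R + kappa) ^+ 2)%:E)%E).
  by rewrite leeD2r// lee_wpmul2l.
by rewrite -EFinM -EFinD lee_fin; exact: descent_rate.
Qed.
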